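(* For every $n\ge 1$ and every deterministic online algorithm $\mathrm{DET}$ for the online multiple knapsack problem with $n$ bins, the competitive ratio of $\mathrm{DET}$ is at most $R - 1/(52n)$, where $R=1/(1+\ln 2)$; i.e., there exists an input sequence $\sigma$ with $\mathrm{OPT}(\sigma)>0$ and $\mathrm{DET}(\sigma) \le (R - 1/(52n))\cdot \mathrm{OPT}(\sigma)$.
   Context: Online multiple knapsack problem (proportional variant): there are $n$ bins, each of capacity $1$. Items with sizes in $(0,1]$ arrive one at a time. Upon arrival of an item, an online algorithm must irrevocably either reject it or place it into one bin so that no bin's total size exceeds $1$, without knowledge of future items. $A(\sigma)$ is the total size of the items accepted by algorithm $A$ on input $\sigma$; $\mathrm{OPT}(\sigma)$ is the maximum total size of a subset of the items of $\sigma$ that can be feasibly packed into the $n$ bins. An algorithm is $\alpha$-competitive if $A(\sigma)\ge \alpha\cdot\mathrm{OPT}(\sigma)$ for every input $\sigma$; its competitive ratio is the supremum of such $\alpha$. *)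

(* Defs.v *)
From HB Require Import structures.
From mathcomp Require Import all_boot all_order all_algebra.
From mathcomp Require Import all_classical all_reals all_analysis.

Set Implicit Arguments.
Unset Strict Implicit.
Unset Printing Implicit Defensive.

Import Order.TTheory GRing.Theory Num.Theory.
Local Open Scope ring_scope.

Section Knapsack.
Variables (R : realType) (n : nat).
Implicit Types (s : seq R) (j : 'I_n).

Definition is_input s : bool := all (fun x => 0 < x <= 1) s.

(* Items are indexed by their arrival position; [None] means rejected. *)
Definition packing s := {ffun 'I_(size s) -> option 'I_n}.

Definition load s (p : packing s) j : R :=
  \sum_(i < size s | p i == Some j) s`_i.

Definition feasible s (p : packing s) : bool := [forall j, load p j <= 1].

Definition value s (p : packing s) : R :=
  \sum_(i < size s | p i != None) s`_i.

(* The default 0 is the value of the packing that rejects everything. *)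
Definition OPT s : R := \big[Num.max/0]_(p : packing s | feasible p) value p.

(* [d h x] is the decision on item [x] after the items [h] have arrived. The
   earlier decisions of a deterministic algorithm are a function of [h], so
   they need not be passed to [d]. *)
Definition run (d : seq R -> R -> option 'I_n) s : packing s :=
  [ffun i : 'I_(size s) => d (take i s) s`_i].

Record online_algorithm := OnlineAlgorithm {
  decide :> seq R -> R -> option 'I_n;
  run_feasible : forall s, is_input s -> feasible (run decide s) }.

Definition ALG (A : online_algorithm) s : R := value (run A s).

Definition competitive (A : online_algorithm) (alpha : R) : Prop :=
  forall s, is_input s -> alpha * OPT s <= ALG A s.

Definition competitive_ratio (A : online_algorithm) : R :=
  sup [set alpha | competitive A alpha]%classic.

Lemma value_ge0 s (p : packing s) : is_input s -> 0 <= value p.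
Proof.
move=> /allP si; apply: sumr_ge0 => i _.
by have /si/andP[/ltW] := mem_nth 0 (ltn_ord i).
Qed.

Lemma OPT_max s (p : packing s) : feasible p -> value p <= OPT s.
Proof. by move=> fp; rewrite /OPT (bigD1 p) //= le_max lexx. Qed.

Lemma OPT_attained s :
  exists2 p : packing s, feasible p & value p = OPT s.
Proof.
rewrite /OPT; elim/big_ind: _ => [|x y [p fp <-] [q fq <-]|p fp].
- exists [ffun=> None].
    by apply/forallP => j; rewrite /load big1 ?ler01 // => i; rewrite ffunE.
  by rewrite /value big1 // => i; rewrite ffunE.
- by case: (leP (value p) (value q)) => _; [exists q | exists p].
- by exists p.
Qed.

(* [sup] is only meaningful on nonempty sets that are bounded above. *)
Lemma has_sup_competitive (A : online_algorithm) :
  (0 < n)%N -> has_sup [set alpha | competitive A alpha]%classic.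
Proof.
move=> n0; split; first by exists 0 => s si; rewrite mul0r value_ge0.
pose s : seq R := [:: 1].
have si : is_input s by rewrite /is_input /= ltr01 lexx.
exists 1 => a /(_ s si) /le_trans /(_ (OPT_max (run_feasible A si))) h.
have v1 : 1 <= OPT s.
  pose p : packing s := [ffun=> Some (Ordinal n0)].
  have fp : feasible p.
    apply/forallP => j; rewrite /load big_mkcond big_ord1 /=.
    by case: ifP => _; rewrite ?lexx ?ler01.
  apply: le_trans (OPT_max fp).
  by rewrite /value big_mkcond big_ord1 ffunE /=.
by rewrite -(ler_pM2r (lt_le_trans ltr01 v1)) mul1r.
Qed.

End Knapsack.

(* Main.v *)
(** Let [r = 1/(1 + ln 2)]. The adversary sends [n] copies of each size
[y_i = (1 + (i+1)/M) / 2], [i < M], stopping after some size. All sizes exceed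
1/2, so the algorithm accepts at most [n] items, while the optimum after size
[y_i] is at least [n y_i]. If the algorithm always kept more than
[alpha = r - 1/(52n)] times the optimum, then every item offered after the first
size would be at most [1/b] times the total accepted so far, where
[b = r n - 1/50] is slightly less than [alpha n] to absorb the step of the grid.
So each later acceptance multiplies the total by at most [1 + 1/b]; with [k]
items of the first size accepted, the final total is at most
[k y_0 (1 + 1/b)^(n-k) <= 2 y_0 b <= alpha n], too small for the last size 1. *)

Require Import Defs.
From HB Require Import structures.
From mathcomp Require Import all_boot all_order all_algebra.
From mathcomp Require Import all_classical all_reals all_analysis.
From mathcomp Require Import ring lra.

Set Implicit Arguments.
Unset Strict Implicit.
Unset Printing Implicit Defensive.

Import Order.TTheory GRing.Theory Num.Theory.
Import numFieldNormedType.Exports.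
Local Open Scope ring_scope.

(** * Elementary bounds on the logarithm and the growth estimate *)

Section Logarithm.
Variable R : realType.
Implicit Types x b k : R.

Lemma ln_le_subr1 x : 0 < x -> ln x <= x - 1.
Proof.
move=> x0; have -> : ln x = ln (1 + (x - 1)) by rewrite addrC subrK.
by apply: le_ln1Dx; lra.
Qed.

Lemma ln_ge_subrV x : 0 < x -> 1 - x^-1 <= ln x.
Proof.
move=> x0; have := @ln_le_subr1 x^-1; rewrite invr_gt0 lnV ?posrE // => /(_ x0).
by lra.
Qed.

(** The difference [x - 1/x - 2 ln x] vanishes at 1 and has derivative [(1 - 1/x)^2]. *)
Lemma ln_le_half_subrV x : 1 <= x -> ln x <= (x - x^-1) / 2.
Proof.
move=> x1; pose f (y : R) := y - y^-1 - 2 * ln y.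
have df (y : R) : 0 < y -> is_derive y 1 f ((1 - y^-1) ^+ 2).
  move=> y0; have yn0 : y != 0 by rewrite gt_eqF.
  have dV : is_derive y 1 (fun z : R => z^-1) (- y ^- 2 *: 1).
    exact: (@is_deriveV _ id).
  have dl := is_derive1_ln y0.
  apply: is_derive_eq; rewrite -exprVn /GRing.scale /=; ring.
have itv0 (y : R) : y \in `[1, x]%R -> 0 < y by rewrite in_itv /=; lra.
have itvW (y : R) : y \in `]1, x[%R -> y \in `[1, x]%R.
  exact: subset_itv_oo_cc.
suff : f 1 <= f x by rewrite /f invr1 ln1; lra.
apply: (@ger0_derive1_le_cc _ f 1 x) => //; rewrite ?in_itv /= ?lexx ?x1 //.
- by move=> y /itvW/itv0/df[].
- by move=> y /itvW/itv0/df dy; rewrite derive1E derive_val sqr_ge0.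
- by apply: derivable_within_continuous => y /itv0/df[].
Qed.

Lemma ln2_bounds : 37 / 60 <= ln (2 : R) <= 3 / 4.
Proof.
apply/andP; split; last first.
  by apply: le_trans (@ln_le_half_subrV 2 _) _; lra.
(* The bound [1 - 1/x] on the three telescoping factors gives [1/4 + 1/5 + 1/6 = 37/60]. *)
have -> : (2 : R) = 4 / 3 * (5 / 4 * (6 / 5)) by field.
rewrite [ln _]lnM ?posrE; try lra.
rewrite [ln (_ * (6 / 5))]lnM ?posrE; try lra.
have l4 : 1 - (4 / 3 : R)^-1 <= ln (4 / 3) by apply: ln_ge_subrV; lra.
have l5 : 1 - (5 / 4 : R)^-1 <= ln (5 / 4) by apply: ln_ge_subrV; lra.
have l6 : 1 - (6 / 5 : R)^-1 <= ln (6 / 5) by apply: ln_ge_subrV; lra.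
by move: l4 l5 l6; rewrite !invf_div; lra.
Qed.

(* With [u = ln (1 + 1/b)], the map [k |-> k (1 + 1/b)^(n - k)] is maximal over
   the reals at [k = 1/u]: this is the bound [ln (k u) <= k u - 1]. It is good
   enough unless [n = 1], where [b] is too small. *)
Lemma geometric_growth_le (n k m : nat) (b := n%:R / (1 + ln 2) - 1 / 50 : R) :
  (0 < n)%N -> (k + m <= n)%N -> k%:R * (1 + b^-1) ^+ m <= 2 * b.
Proof.
move=> n0 kmn; have /andP[L1 L2] := ln2_bounds; set L : R := ln 2 in b L1 L2 *.
have nE : n%:R = (1 + L) * (b + 1 / 50) by rewrite /b; field; lra.
have nge1 : 1 <= n%:R :> R by rewrite ler1n.
have b2 : 1 <= 2 * b by nra.
case: k kmn => [|k] kmn; first by rewrite mul0r; lra.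
have [n1|n2] : n = 1%N \/ (1 < n)%N by case: (n) n0 => [|[|?]] //; auto.
  by move: kmn; rewrite n1; case: k; case: m => // _; rewrite expr0 mulr1.
have {}n2 : 2 <= n%:R :> R by rewrite (ler_nat _ 2).
(* From [n >= 2] and [L <= 3/4], since [8/7 - 1/50 >= 28/25]. *)
have b9 : 28 / 25 <= b by nra.
(* [v] lies slightly below 1: the gap [1 - v], at least [1/(2(b + 1))], pays for the excess
   [(1 + L)/50] of [n] over [(1 + L) b]. *)
set u := ln (1 + b^-1); set v := b * u.
have bV : 0 < b^-1 by rewrite invr_gt0; lra.
have bbV : b * b^-1 = 1 by rewrite divff //; lra.
have bSV : (1 + b^-1)^-1 = b / (b + 1).
  by field; apply/andP; split; lra.
have u_le : u <= b^-1 by apply: le_ln1Dx; lra.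
have v_ge : b <= v * (b + 1).
  have := @ln_ge_subrV (1 + b^-1); rewrite -/u bSV => /(_ _) H.
  have {}H : 1 - b / (b + 1) <= u by apply: H; lra.
  have e : b = b * (1 - b / (b + 1)) * (b + 1) by field; lra.
  by rewrite [leLHS]e ler_wpM2r ?ler_wpM2l //; lra.
have v_le : 1 <= (1 - v) * (2 * (b + 1)).
  have := @ln_le_half_subrV (1 + b^-1); rewrite -/u bSV => /(_ _) H.
  have {}H : u <= (1 + b^-1 - b / (b + 1)) / 2 by apply: H; lra.
  have e : 1 = (1 - b * ((1 + b^-1 - b / (b + 1)) / 2)) * (2 * (b + 1)).
    by field; apply/andP; split; lra.
  rewrite [leLHS]e ler_wpM2r ?lerB ?ler_wpM2l //; lra.
have v0 : 0 < v by nra.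
have v1 : v < 1 by nra.
have u0 : 0 < u by rewrite -(pmulr_rgt0 _ (_ : 0 < b)) //; lra.
have k0 : 0 < k.+1%:R :> R by rewrite ltr0n.
have m_le : m%:R <= n%:R - k.+1%:R :> R by rewrite lerBrDl -natrD ler_nat.
have lnvV : ln v^-1 <= (v^-1 - v) / 2.
  have := @ln_le_half_subrV v^-1; rewrite invrK invr_ge1 ?unitfE ?gt_eqF //.
  by apply; lra.
have lnku : ln (k.+1%:R * u) <= k.+1%:R * u - 1 by apply: ln_le_subr1; nra.
rewrite -ler_ln ?posrE ?mulr_gt0 ?exprn_gt0 //; try lra.
rewrite [ln (_ * _ ^+ _)]lnM ?posrE ?exprn_gt0 //; try lra.
rewrite [ln (2 * _)]lnM ?posrE; try lra.
rewrite lnXn; last lra.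
rewrite -/L -/u -[u *+ m]mulr_natl.
move: lnvV lnku; rewrite lnV ?posrE // lnM ?posrE // lnM ?posrE //; last lra.
have mu : m%:R * u <= (n%:R - k.+1%:R) * u by rewrite ler_wpM2r // ltW.
move=> lnv lnk.
(* Here [k] cancels: [ln k + m u <= n u - 1 - ln u], and [- ln u - ln b = ln v^-1] is bounded by
   [lnvV]. *)
suff : n%:R * u - 1 + (v^-1 - v) / 2 <= L by lra.
have vV_le : v^-1 <= 1 + b^-1.
  by rewrite -[leLHS]mul1r ler_pdivrMr //; nra.
(* By [nE], what remains is [(1 + L) u / 50 <= (1 - v)(L + 1/2 - 1/(2v))]; [vV_le] bounds the last
   factor below by [L - 1/(2b)]. *)
have c_le : (1 + L) / 50 * b^-1 <= (1 - v) * (L - b^-1 / 2).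
  have Lb0 : 0 <= L - b^-1 / 2 by nra.
  apply: le_trans (_ : (L - b^-1 / 2) / (2 * (b + 1)) <= _); last first.
    by rewrite ler_pdivrMr; nra.
  rewrite ler_pdivlMr; last lra.
  nra.
have vvV : v * v^-1 = 1 by rewrite divff // gt_eqF.
have : (1 + L) / 50 * u <= (1 + L) / 50 * b^-1 by rewrite ler_wpM2l //; lra.
rewrite nE.
have e : (1 + L) * (b + 1 / 50) * u = (1 + L) * v + (1 + L) / 50 * u.
  by rewrite /v; ring.
rewrite e.
have : (1 - v) * (v^-1 - 1 - b^-1) <= 0 by rewrite mulr_ge0_le0 //; lra.
by lra.
Qed.
End Logarithm.

(** * Packings and runs on finite prefixes of an infinite sequence *)

Section Adversary.
Variables (R : realType) (n : nat).
Implicit Types (f : nat -> R) (N : nat).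

Lemma take_mkseq T (f : nat -> T) i N :
  (i <= N)%N -> take i (mkseq f N) = mkseq f i.
Proof. by move=> iN; rewrite /mkseq -map_take take_iota (minn_idPl iN). Qed.

(** The choice of [P] covers both [load] and [value]; [D] extends the packing to all natural
    indices, so that sums can be split over ranges. *)
Lemma big_packing_mkseq f N (p : packing n (mkseq f N))
    (P : pred (option 'I_n)) (D : nat -> option 'I_n) :
  (forall i, p i = D i) ->
  \sum_(i < size (mkseq f N) | P (p i)) (mkseq f N)`_i =
  \sum_(0 <= t < N | P (D t)) f t.
Proof.
move=> pD; under eq_bigl do rewrite pD.
rewrite -(big_mkord (fun i => P (D i)) (fun i => (mkseq f N)`_i)) size_mkseq.
rewrite big_nat_cond [RHS]big_nat_cond.
by apply: eq_bigr => i /andP[/andP[_ iN] _]; rewrite nth_mkseq.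
Qed.

Lemma is_input_mkseq f N :
  (forall t, (t < N)%N -> 0 < f t <= 1) -> is_input (mkseq f N).
Proof.
move=> f01; apply/(all_nthP 0) => i; rewrite size_mkseq => iN.
by rewrite nth_mkseq ?f01.
Qed.

(** Reject the first [N] items and put item [N + j] alone into bin [j]. *)
Lemma OPT_ge_last_items f N (y : R) :
  0 <= y <= 1 -> (forall t, (N <= t < N + n)%N -> f t = y) ->
  n%:R * y <= OPT n (mkseq f (N + n)).
Proof.
move=> y01 fy.
pose D t : option 'I_n := if (t < N)%N then None else insub (t - N)%N.
pose p : packing n (mkseq f (N + n)) :=
  [ffun i : 'I_(size (mkseq f (N + n))) => D i].
have pD i : p i = D i by rewrite ffunE.
have DE t j : (D t == Some j) = (t == N + j)%N.
  rewrite /D; case: ltnP => tN.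
    by apply/esym/eqP => tE; move: tN; rewrite tE ltnNge leq_addr.
  case: insubP => [i _ ti|tn].
    by rewrite -[LHS]val_eqE /= ti -(eqn_add2l N) subnKC.
  apply/esym/eqP => tE; move: tn; rewrite tE addKn.
  by rewrite ltn_ord.
have -> : n%:R * y = value p.
  rewrite /value (big_packing_mkseq (fun o => o != None) pD) /=.
  rewrite (@big_cat_nat _ _ _ N) ?leq_addr //=.
  rewrite big_nat_cond big1 ?add0r; last first.
    by move=> t /andP[/andP[_ tN]]; rewrite /D tN.
  rewrite big_nat_cond (eq_big (fun t => N <= t < N + n)%N (fun=> y)).
  - by rewrite -big_nat big_const_nat iter_addr_0 addKn mulr_natl.
  - move=> t; case: (boolP (N <= t < N + n)%N) => //= /andP[Nt tNn].
    rewrite /D ltnNge Nt /= insubT ?ltn_subLR //.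
  - by move=> t /andP[/fy].
apply: OPT_max; apply/forallP => j.
rewrite /load (big_packing_mkseq (fun o => o == Some j) pD) /=.
rewrite (eq_bigl _ _ (DE^~ j)) big_nat1_eq /=.
by rewrite ltn_add2l ltn_ord fy ?leq_addr ?ltn_add2l ?ltn_ord //; lra.
Qed.

Variable A : online_algorithm R n.

Definition decision f (t : nat) : option 'I_n := A (mkseq f t) (f t).

(** Decisions do not depend on [N], so one fixed sequence stopped at different times can serve as
    the adversary. *)
Lemma run_mkseq f N i : run A (mkseq f N) i = decision f i.
Proof.
have iN : (i < N)%N by rewrite -[ltnRHS](size_mkseq f) ltn_ord.
by rewrite ffunE take_mkseq ?nth_mkseq // ltnW.
Qed.

Lemma ALG_mkseq f N :
  ALG A (mkseq f N) = \sum_(0 <= t < N | decision f t != None) f t.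
Proof. exact: (big_packing_mkseq (fun o => o != None) (@run_mkseq f N)). Qed.

Lemma load_run_mkseq f N j :
  load (run A (mkseq f N)) j =
  \sum_(0 <= t < N | decision f t == Some j) f t.
Proof. exact: (big_packing_mkseq (fun o => o == Some j) (@run_mkseq f N)). Qed.

(** Two items larger than 1/2 never share a bin, so each bin receives at most one. *)
Lemma accepted_big_items f N h :
  1 / 2 < h -> (forall t, (t < N)%N -> h <= f t <= 1) ->
  (\sum_(0 <= t < N | decision f t != None) 1 <= n)%N.
Proof.
move=> h2 fb; have si : is_input (mkseq f N).
  by apply: is_input_mkseq => t /fb; lra.
rewrite (partition_big (decision f) (predC1 None)) //=.
rewrite -[leqRHS]card_ord -[leqRHS]/(#|'I_n|.+1.-1) -card_option.
rewrite -(cardC1 (None : option 'I_n)) -sum1_card; apply: leq_sum => -[j|//] _.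
have := run_feasible A si => /forallP/(_ j); rewrite load_run_mkseq.
rewrite (eq_bigl (fun t => decision f t == Some j)) => [|t]; last first.
  by case: (decision f t).
set c := (\sum_(_ <= t < _ | _) 1)%N; rewrite leqNgt => load1; apply/negP => c2.
have c_le : c%:R * h <= \sum_(0 <= t < N | decision f t == Some j) f t.
  rewrite natr_sum mulr_suml big_nat_cond [leRHS]big_nat_cond.
  by apply: ler_sum => t /andP[/andP[_ /fb /andP[ht _]] _]; rewrite mul1r.
have : 2 <= c%:R :> R by rewrite (ler_nat _ 2).
by nra.
Qed.

End Adversary.

(** Accepting an item of size at most [q - 1] times the running total multiplies that total by at
    most [q]; a rejection leaves it unchanged. *)
Lemma accepted_growth (R : realType) (acc : pred nat) (f : nat -> R) (q : R)
    m N :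
  0 <= q -> (m <= N)%N ->
  (forall t, (m <= t < N)%N ->
     f t <= (q - 1) * \sum_(0 <= i < t | acc i) f i) ->
  \sum_(0 <= i < N | acc i) f i <=
  (\sum_(0 <= i < m | acc i) f i) * q ^+ (\sum_(m <= i < N | acc i) 1).
Proof.
move=> q0 /subnK <-; elim: (N - m)%N => [|d IH] fle.
  by rewrite add0n [X in q ^+ X]big_geq // expr0 mulr1.
have dm : (m <= d + m)%N by rewrite leq_addl.
have {}IH : \sum_(0 <= i < d + m | acc i) f i <=
    (\sum_(0 <= i < m | acc i) f i) * q ^+ (\sum_(m <= i < d + m | acc i) 1).
  by apply: IH => t /andP[mt td]; apply: fle; rewrite mt addSn ltnS ltnW.
rewrite addSn; rewrite [leLHS]big_mkcond [X in q ^+ X]big_mkcond /=.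
rewrite !big_nat_recr //= -!big_mkcond /=.
have := fle (d + m)%N; rewrite dm addSn ltnSn => /(_ isT).
case: (acc _); last by rewrite addr0 addn0.
rewrite addn1 exprSr => fd.
apply: le_trans (_ : (\sum_(0 <= i < d + m | acc i) f i) * q <= _); first lra.
by rewrite mulrA ler_wpM2r.
Qed.

Theorem theorem28 (R : realType) (n : nat) (hn : (1 <= n)%N)
    (DET : online_algorithm R n) :
  competitive_ratio DET <= 1 / (1 + ln (2 : R)) - 1 / (52 * n%:R) /\
  exists sigma : seq R,
    [/\ is_input sigma,
        0 < OPT n sigma &
        ALG DET sigma <=
          (1 / (1 + ln (2 : R)) - 1 / (52 * n%:R)) * OPT n sigma].
Proof.
set alpha := 1 / (1 + ln 2) - _.
suff ex : exists sigma, [/\ is_input sigma, 0 < OPT n sigma &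
    ALG DET sigma <= alpha * OPT n sigma].
  split=> //; case: ex => s [si s0 sA].
  apply: ge_sup => [|x /(_ s si) xs].
    by case: (has_sup_competitive DET hn).
  by rewrite -(ler_pM2r s0) (le_trans xs).
apply: contrapT => nex.
have /andP[L1 L2] := ln2_bounds R.
have n1 : 1 <= n%:R :> R by rewrite ler1n.
pose b : R := n%:R / (1 + ln 2) - 1 / 50.
have nE : n%:R = (1 + ln 2) * (b + 1 / 50) :> R by rewrite /b; field; lra.
have aE : alpha * n%:R = b + 1 / 50 - 1 / 52.
  by rewrite /alpha /b; field; rewrite !gt_eqF //; lra.
have b_gt0 : 0 < b by nra.
have b_le : b <= n%:R by nra.
(* [alpha n] exceeds [b] by [1/50 - 1/52 = 1/1300], while a grid step costs [b/M <= n/M]. *)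
pose M := (1300 * n)%N.
have MR : M%:R = 1300 * n%:R :> R by rewrite natrM.
have M_gt0 : 0 < M%:R :> R by lra.
have bM_le : (1 + M%:R^-1) * b <= alpha * n%:R.
  rewrite aE mulrDl mul1r; suff : M%:R^-1 * b <= 1 / 1300 by lra.
  by rewrite ler_pdivrMl // MR; lra.
pose y (i : nat) : R := (1 + i.+1%:R / M%:R) / 2.
pose f t := y (t %/ n)%N.
have y_ge i : y 0%N <= y i.
  by rewrite /y ler_pM2r ?lerD2l ?ler_pM2r ?invr_gt0 ?ler_nat //; lra.
have MV : 0 < M%:R^-1 :> R by rewrite invr_gt0.
have y0E : y 0%N = (1 + M%:R^-1) / 2 by rewrite /y div1r.
have y0_gt : 1 / 2 < y 0%N by rewrite y0E; lra.
have y_le i : (i < M)%N -> y i <= 1.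
  move=> iM; suff : i.+1%:R / M%:R <= 1 :> R by rewrite /y; lra.
  by rewrite ler_pdivrMr // mul1r ler_nat.
have y_S i : y i.+1 <= (1 + M%:R^-1) * y i.
  have -> : y i.+1 = y i + M%:R^-1 / 2 by rewrite /y -[in LHS]natr1; ring.
  by have := y_ge i; nra.
have f_itv t : (t < M * n)%N -> y 0%N <= f t <= 1.
  by move=> tMn; rewrite y_ge y_le // ltn_divLR.
pose T N := \sum_(0 <= t < N | decision DET f t != None) f t.
(* Otherwise the prefix ending with the block of size [y m] is the input denied by [nex]. *)
have T_gt m : (m < M)%N -> alpha * n%:R * y m < T (m.+1 * n)%N.
  move=> mM; rewrite ltNge; apply/negP => T_le; apply: nex.
  have OPT_ge : n%:R * y m <= OPT n (mkseq f (m.+1 * n)).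
    rewrite mulSn addnC; apply: OPT_ge_last_items.
      by rewrite y_le // andbT; have := y_ge m; lra.
    move=> t /andP[mt tm].
    congr y; apply/eqP; rewrite eqn_leq -ltnS ltn_divLR // leq_divRL // mt.
    by rewrite mulSn addnC tm.
  exists (mkseq f (m.+1 * n)%N); split.
  - apply: is_input_mkseq => t tmn; have : (t < M * n)%N.
      by apply: leq_trans tmn _; rewrite leq_mul2r mM orbT.
    by move/f_itv=> /andP[ft ->]; rewrite andbT; lra.
  - by apply: lt_le_trans OPT_ge; have := y_ge m; nra.
  - rewrite ALG_mkseq; apply: le_trans T_le _.
    by rewrite -mulrA ler_wpM2l //; nra.
have T_mono N N' : (N <= N' <= M * n)%N -> T N <= T N'.
  move=> /andP[NN' N'M]; rewrite /T [leRHS](big_cat_nat (n := N)) //=.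
  rewrite lerDl big_nat_cond sumr_ge0 // => t /andP[/andP[_ tN']] _.
  by have /andP[] := f_itv t (leq_trans tN' N'M); lra.
have M0 : (0 < M)%N by rewrite -(ltr_nat R).
have nMn : (n <= M * n)%N by rewrite leq_pmull.
pose k := (\sum_(0 <= t < n | decision DET f t != None) 1)%N.
pose m := (\sum_(n <= t < M * n | decision DET f t != None) 1)%N.
have km : (k + m <= n)%N.
  by rewrite -big_cat_nat //; exact: accepted_big_items y0_gt f_itv.
have Tn : T n = k%:R * y 0%N.
  rewrite natr_sum mulr_suml /T big_nat_cond [RHS]big_nat_cond.
  by apply: eq_bigr => t /andP[/andP[_ tn] _]; rewrite mul1r /f divn_small.
have q0 : 0 <= 1 + b^-1 :> R by rewrite addr_ge0 // invr_ge0 ltW.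
have := @accepted_growth _ [pred t | decision DET f t != None] f _ _ _ q0 nMn.
rewrite -/(T _) -/(T _) -/m Tn => /(_ _) growth.
have {growth} : T (M * n)%N <= k%:R * y 0%N * (1 + b^-1) ^+ m.
  apply: growth => t /andP[nt tM]; rewrite addrC addKr.
  have [i ti] : exists i, (t %/ n)%N = i.+1.
    by exists (t %/ n).-1; rewrite prednK // divn_gt0.
  have iM : (i.+1 < M)%N by rewrite -ti ltn_divLR.
  have it : (i.+1 * n <= t)%N by rewrite -ti leq_trunc_div.
  rewrite ler_pdivlMl // /f ti.
  (* At time [t] only the blocks up to [y i] are surely complete, so [T t] is compared with [y i];
     passing to [y i.+1] costs the factor [1 + 1/M] absorbed by [bM_le]. *)
  apply: le_trans (_ : alpha * n%:R * y i <= _); last first.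
    apply: le_trans (ltW (T_gt _ (ltnW iM))) _.
    by apply: T_mono; rewrite it ltnW.
  apply: le_trans (_ : b * ((1 + M%:R^-1) * y i) <= _).
    by rewrite ler_wpM2l // ltW.
  by rewrite mulrA (mulrC b) ler_wpM2r //; have := y_ge i; lra.
have := geometric_growth_le R hn km; rewrite -/b => growth.
have := T_gt M.-1; rewrite prednK // => /(_ (leqnn _)).
have -> : y M.-1 = 1 by rewrite /y prednK // divff ?gt_eqF //; lra.
move=> aT Tq; move: aT; apply/negP; rewrite mulr1 -leNgt.
apply: le_trans Tq _; apply: le_trans bM_le.
have -> : k%:R * y 0%N * (1 + b^-1) ^+ m =
          y 0%N * (k%:R * (1 + b^-1) ^+ m) by ring.
have -> : (1 + M%:R^-1) * b = y 0%N * (2 * b) by rewrite y0E; field; lra.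
by rewrite ler_wpM2l //; lra.
Qed.
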